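(* Let $n\ge 1$ and let $\bm{f}=(f_1,\dots,f_n)^\top:\mathbb{R}_{\max}^n\to\mathbb{R}_{\max}^n$ be a map with $\bm{f}(\bm{\varepsilon})=\bm{\varepsilon}$, so that $\bm{\varepsilon}$ is a fixed point of the difference equation $\bm{x}^{(t+1)}=\bm{f}(\bm{x}^{(t)})$, $t\in\mathbb{Z}_{\ge 0}$. Suppose that $\bm{f}$ is tropical-linearly approximated at $\bm{\varepsilon}$, and let $J_{\bm{\varepsilon}}\bm{f}\in\mathbb{R}_{\max}^{n\times n}$ be its tropical Jacobian matrix at $\bm{\varepsilon}$. If the maximum (tropical) eigenvalue of $J_{\bm{\varepsilon}}\bm{f}$ is positive, then the fixed point $\bm{\varepsilon}$ is unstable.
   Context: Tropical semiring: $\mathbb{R}_{\max}=\mathbb{R}\cup\{-\infty\}$ with $a\oplus b=\max(a,b)$, $a\otimes b=a+b$, $\varepsilon:=-\infty$ (the additive identity), and $a\oslash b=a-b$ for $b\in\mathbb{R}$ (with $\varepsilon\oslash b=\varepsilon$). Matrix products: $[A\otimes B]_{ij}=\max_k([A]_{ik}+[B]_{kj})$; scalar multiples $\alpha\otimes\bm{x}$ are entrywise. $\bm{\varepsilon}=(\varepsilon,\dots,\varepsilon)^\top\in\mathbb{R}_{\max}^n$. Distance: $d(\bm{x},\bm{y})=\max_{i}|e^{x_i}-e^{y_i}|$ on $\mathbb{R}_{\max}^n$, with $e^{\varepsilon}=0$ (also used for $n=1$); $\|\bm{x}\|:=d(\bm{x},\bm{\varepsilon})=\max_i e^{x_i}$.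 All limits are with respect to $d$. Eigenvalues: $\lambda\in\mathbb{R}_{\max}$ is an eigenvalue of $A\in\mathbb{R}_{\max}^{n\times n}$ if there is $\bm{x}\in\mathbb{R}_{\max}^n\setminus\{\bm{\varepsilon}\}$ with $A\otimes\bm{x}=\lambda\otimes\bm{x}$. Tropical linear approximation: for $g:\mathbb{R}_{\max}^n\to\mathbb{R}_{\max}$ with $g(\bm{\varepsilon})=\varepsilon$ and a row vector $\bm{a}\in\mathbb{R}_{\max}^{1\times n}$, the form $\bm{a}\otimes\bm{x}$ is a tropical linear approximation of $g$ at $\bm{\varepsilon}$ if $\lim_{\bm{x}\to\bm{\varepsilon}} d(g(\bm{x}),\bm{a}\otimes\bm{x})/\|\bm{x}\|=0$ (limit over $\bm{x}\ne\bm{\varepsilon}$). Tropical derivative and Jacobian: for $\bm{x}\in\mathbb{R}_{\max}^n$, $\bm{x}(j)$ is the vector whose $j$th entry is $x_j$ and whose other entries are $\varepsilon$. $D_{j,\bm{\varepsilon}}g:=\lim_{x_j\to\varepsilon} g(\bm{x}(j))\oslash x_j$ (over finite $x_j$), and $[J_{\bm{\varepsilon}}\bm{f}]_{ij}:=D_{j,\bm{\varepsilon}}f_i$. The map $\bm{f}$ is tropical-linearly approximated at $\bm{\varepsilon}$ if each $f_i$ has a tropical linear approximation at $\bm{\varepsilon}$; this is written $\bm{f}(\bm{x})\approx J_{\bm{\varepsilon}}\bm{f}\otimes\bm{x}$, i.e. the coefficient vector for $f_i$ is the $i$th row of $J_{\bm{\varepsilon}}\bm{f}$. Stability: the fixed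 point $\bm{\varepsilon}$ is stable if for all $\alpha>0$ there is $\delta>0$ such that $\|\bm{x}^{(0)}\|<\delta$ implies $\|\bm{x}^{(t)}\|<\alpha$ for all $t\in\mathbb{Z}_{\ge0}$; otherwise it is unstable. *)

(* Defs.v *)
From mathcomp Require Import all_boot all_order all_algebra.
From mathcomp Require Import all_classical all_reals all_analysis.

Set Implicit Arguments.
Unset Strict Implicit.
Unset Printing Implicit Defensive.

Import Order.TTheory GRing.Theory Num.Theory.
Local Open Scope ring_scope.

(* The tropical semiring: [Some r] is the finite element r, [None] is -oo. *)
Definition Rmax (R : realType) : Type := option R.

Definition tzero {R : realType} : Rmax R := None.

Definition tfin {R : realType} (r : R) : Rmax R := Some r.

Definition tadd {R : realType} (x y : Rmax R) : Rmax R :=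
  match x, y with
  | Some a, Some b => Some (Num.max a b)
  | Some a, None => Some a
  | None, _ => y
  end.

Definition tmul {R : realType} (x y : Rmax R) : Rmax R :=
  match x, y with
  | Some a, Some b => Some (a + b)
  | _, _ => None
  end.

Definition tdiv {R : realType} (x : Rmax R) (b : R) : Rmax R :=
  match x with
  | Some a => Some (a - b)
  | None => None
  end.

Definition tle {R : realType} (x y : Rmax R) : Prop :=
  match x, y with
  | Some a, Some b => a <= b
  | Some _, None => False
  | None, _ => True
  end.

Definition tlt {R : realType} (x y : Rmax R) : Prop :=
  match x, y with
  | Some a, Some b => a < b
  | None, Some _ => True
  | _, None => False
  end.

Definition tmulmx {R : realType} {m n p : nat}
    (A : 'M[Rmax R]_(m, n)) (B : 'M[Rmax R]_(n, p)) : 'M[Rmax R]_(m, p) :=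
  \matrix_(i < m, j < p) \big[tadd/tzero]_(k < n) tmul (A i k) (B k j).

Definition tscale {R : realType} {n : nat}
    (a : Rmax R) (x : 'cV[Rmax R]_n) : 'cV[Rmax R]_n :=
  \col_(i < n) tmul a (x i 0).

Definition tzerov {R : realType} {n : nat} : 'cV[Rmax R]_n :=
  \col_(i < n) tzero.

Definition texp {R : realType} (x : Rmax R) : R :=
  match x with
  | Some r => expR r
  | None => 0
  end.

Definition tdist {R : realType} (x y : Rmax R) : R := `|texp x - texp y|.

(* The default value 0 of the maximum is harmless: all terms are
   nonnegative. *)
Definition tdistv {R : realType} {n : nat} (x y : 'cV[Rmax R]_n) : R :=
  \big[Num.max/0]_(i < n) tdist (x i 0) (y i 0).

Definition tnorm {R : realType} {n : nat} (x : 'cV[Rmax R]_n) : R :=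
  tdistv x tzerov.

Definition teigenvalue {R : realType} {n : nat}
    (A : 'M[Rmax R]_n) (lam : Rmax R) : Prop :=
  exists x : 'cV[Rmax R]_n, x <> tzerov /\ tmulmx A x = tscale lam x.

Definition is_max_teigenvalue {R : realType} {n : nat}
    (A : 'M[Rmax R]_n) (lam : Rmax R) : Prop :=
  teigenvalue A lam /\ forall mu : Rmax R, teigenvalue A mu -> tle mu lam.

(* [a] (x) x is a tropical linear approximation of [g] at the vector -oo: the
   quotient d(g(x), a (x) x) / ||x||, which is nonnegative, tends to 0. *)
Definition is_tlinear_approx {R : realType} {n : nat}
    (g : 'cV[Rmax R]_n -> Rmax R) (a : 'rV[Rmax R]_n) : Prop :=
  forall e : R, 0 < e -> exists delta : R, 0 < delta /\
    forall x : 'cV[Rmax R]_n, x <> tzerov -> tnorm x < delta ->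
      tdist (g x) (tmulmx a x 0 0) / tnorm x < e.

Definition tlinearly_approximated {R : realType} {n : nat}
    (f : 'cV[Rmax R]_n -> 'cV[Rmax R]_n) : Prop :=
  forall i : 'I_n, exists a : 'rV[Rmax R]_n,
    is_tlinear_approx (fun x => f x i 0) a.

Definition tsingle {R : realType} {n : nat} (j : 'I_n) (x : Rmax R) :
    'cV[Rmax R]_n :=
  \col_(i < n) (if i == j then x else tzero).

(* [l] is the limit, for the distance d, of g(x(j)) (/) x_j as the finite
   number x_j tends to -oo. *)
Definition is_tderiv {R : realType} {n : nat}
    (g : 'cV[Rmax R]_n -> Rmax R) (j : 'I_n) (l : Rmax R) : Prop :=
  forall e : R, 0 < e -> exists delta : R, 0 < delta /\
    forall r : R, tdist (tfin r) tzero < delta ->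
      tdist (tdiv (g (tsingle j (tfin r))) r) l < e.

(* The value of the limit above, and -oo by convention if there is none;
   every entry of the Jacobian of a tropical-linearly approximated map is a
   genuine limit. *)
Definition tderiv {R : realType} {n : nat}
    (g : 'cV[Rmax R]_n -> Rmax R) (j : 'I_n) : Rmax R :=
  xget (None : option R) (fun l : option R => is_tderiv g j l).

Definition tjacobian {R : realType} {n : nat}
    (f : 'cV[Rmax R]_n -> 'cV[Rmax R]_n) : 'M[Rmax R]_n :=
  \matrix_(i < n, j < n) tderiv (fun x => f x i 0) j.

Definition tstable {R : realType} {n : nat}
    (f : 'cV[Rmax R]_n -> 'cV[Rmax R]_n) : Prop :=
  forall alpha : R, 0 < alpha -> exists delta : R, 0 < delta /\
    forall x0 : 'cV[Rmax R]_n, tnorm x0 < delta ->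
      forall t : nat, tnorm (iter t f x0) < alpha.

Definition tunstable {R : realType} {n : nat}
    (f : 'cV[Rmax R]_n -> 'cV[Rmax R]_n) : Prop := ~ tstable f.

(* Main.v *)
Require Import Defs.
From mathcomp Require Import all_boot all_order all_algebra.
From mathcomp Require Import all_classical all_reals all_analysis.
From mathcomp Require Import ring lra.

(** Exponentiating turns the tropical semiring into the nonnegative reals with
    max and product, where the Jacobian is a nonnegative matrix [A] with an
    eigenvalue [g > 1].  Choose weights [u >= 0] of maximal support such that
    [h x := max_j u_j x_j] satisfies [h (A x) >= g h x].  By a theorem of
    alternatives, maximality yields positive weights [z] on the complement of
    the support for which [A] grows there by a factor strictly below [g].  The
    cone [x_i <= h x * z_i] is therefore invariant under small perturbations of
    [A]; on it the norm is comparable to [h], which grows geometrically, so an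
    orbit starting in the cone leaves every sufficiently small ball. *)

Import Order.TTheory GRing.Theory Num.Theory.
Local Open Scope ring_scope.

(** * Max-times linear algebra: alternatives and the expanding cone *)

Lemma ex_small_scale (R : realFieldType) (I : finType) (a b : I -> R) :
  (forall i, 0 < b i) -> exists2 e : R, 0 < e & forall i, e * a i < b i.
Proof.
(* The summand 1 makes [s] positive and strictly larger than each quotient. *)
move=> b0; pose s := 1 + \sum_i `|a i| / b i.
have s0 : 0 < s.
  by rewrite ltr_pwDl// sumr_ge0// => i _; rewrite divr_ge0// ltW.
exists s^-1 => [|i]; first by rewrite invr_gt0.
rewrite mulrC ltr_pdivrMr// mulrC -ltr_pdivrMr//.
apply: (@le_lt_trans _ _ (`|a i| / b i)).
  by rewrite ler_pM2r ?invr_gt0// ler_norm.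
rewrite /s (bigD1 i)//= addrCA ltrDl ltr_pwDl// sumr_ge0// => j _.
by rewrite divr_ge0// ltW.
Qed.

(** A maximum truncated at 0: the last clause reduces a claim about [M] to the value 0 or to a
    single attaining index. *)
Lemma ex_seq_max0 (R : realDomainType) (I : eqType) (s : seq I) (F : I -> R) :
  exists M : R, [/\ 0 <= M, {in s, forall j, F j <= M} &
    M = 0 \/ exists2 j, j \in s & M = F j].
Proof.
elim: s => [|k s [M [M0 leM eqM]]]; first by exists 0; split => //; left.
have [leFM|ltMF] := leP (F k) M.
  exists M; split=> // [j|].
    by rewrite inE => /predU1P[->//|]; exact: leM.
  by case: eqM => [->|[j js ->]]; [left|right; exists j; rewrite // inE js orbT].
exists (F k); split=> [|j|]; first exact: le_trans (ltW ltMF).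
  by rewrite inE => /predU1P[->//|/leM/le_trans]; apply; exact: ltW.
by right; exists k; rewrite // mem_head.
Qed.

(* Fourier-Motzkin elimination in the max-times semiring: removing the index
   [k] replaces [A i j] by the best of the direct step and the detour by [k]. *)
Lemma maxtimes_alternative (R : realFieldType) (I : finType) (g : R)
    (s : seq I) (A : I -> I -> R) :
  0 < g -> uniq s -> (forall i j, 0 <= A i j) ->
  (exists u : I -> R, [/\ forall i, 0 <= u i, forall i, i \notin s -> u i = 0,
     exists i, 0 < u i & forall j, exists i, g * u j <= u i * A i j]) \/
  (exists w : I -> R, (forall i, 0 < w i) /\
     {in s &, forall i j, A i j * w j < g * w i}).
Proof.
move=> g0; elim: s A => [|k s IH] A; first by right; exists (fun=> 1); split.
move=> /= /andP[ks us] A0.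
(* If the loop at [k] already reaches [g], the indicator of [k] serves as [u]. Otherwise [A k k < g]
   settles the diagonal inequality for [w] at [k]. *)
have [gA|Ag] := leP g (A k k).
  left; exists (fun i => (i == k)%:R); split=> [i|i||j].
  - exact: ler0n.
  - by rewrite inE negb_or => /andP[/negbTE->].
  - by exists k; rewrite eqxx ltr01.
  - exists k; rewrite eqxx mul1r; case: eqVneq => [->|_].
      by rewrite mulr1.
    by rewrite mulr0.
pose B i j := Num.max (A i j) (A i k * A k j / g).
have B0 i j : 0 <= B i j by rewrite le_max A0.
have [[u [u0 us0 [i0 ui0] hu]]|[w [w0 hw]]] := IH B us B0.
  left.
  have uk : u k = 0 by exact: us0.
  (* [U] is the largest weight at [k] that a step from some [i] supports. Being at least
     [u i * A i k / g], it lets [k] replace the origin [i] of any detour. *)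
  have [U [U0 leU eqU]] := ex_seq_max0 _ _ (enum I) (fun i => u i * A i k / g).
  pose u' i := if i == k then U else u i.
  have uu' i : u i <= u' i by rewrite /u'; case: eqVneq => // ->; rewrite uk.
  exists u'; split=> [i|i||j].
  - exact: le_trans (uu' i).
  - by rewrite inE negb_or /u' => /andP[/negbTE-> /us0].
  - by exists i0; exact: lt_le_trans (uu' i0).
  - rewrite {1}/u'; case: eqVneq => [->|jk].
      case: eqU => [->|[i _ ->]].
        by exists k; rewrite mulr0 mulr_ge0// (le_trans _ (uu' k)).
      by exists i; rewrite mulrC divfK ?gt_eqF// ler_wpM2r.
    have [i] := hu j; rewrite /B; case: (leP (A i j)) => _ le.
      exists k; apply: (le_trans le); rewrite /u' eqxx.
      apply: (@le_trans _ _ (u i * A i k / g * A k j)); last first.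
        by rewrite ler_wpM2r// leU// mem_enum.
      by rewrite le_eqVlt; apply/orP; left; apply/eqP; ring.
    by exists i; apply: (le_trans le); rewrite ler_wpM2r.
right.
(* Row [k] asks for a weight above [M], and column [k] for [A i k] times it to stay below [g * w i].
   The detour terms of [B] make these compatible ([gap]), so [M + e] works for small [e]. *)
have [M [M0 leM eqM]] := ex_seq_max0 _ _ s (fun j => A k j * w j / g).
have gap i : i \in s -> A i k * M < g * w i.
  move=> si; case: eqM => [->|[j sj ->]]; first by rewrite mulr0 mulr_gt0.
  apply: le_lt_trans (hw i j si sj).
  rewrite (_ : _ * _ = A i k * A k j / g * w j); last by ring.
  by rewrite ler_wpM2r ?(ltW (w0 _))// le_max lexx orbT.
have [|e e0 he] := @ex_small_scale R I (fun i => A i k)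
    (fun i => if i \in s then g * w i - A i k * M else 1).
  by move=> i /=; case: ifP => // /gap; rewrite subr_gt0.
exists (fun i => if i == k then M + e else w i); split=> [i|i j].
  by case: eqP => // _; exact: ltr_wpDl.
have notk x : x \in s -> (x == k) = false.
  by move=> sx; apply/negbTE; apply: contraNneq ks => <-.
rewrite !inE => /predU1P[->|si] /predU1P[->|sj].
- by rewrite eqxx ltr_pM2r// ltr_wpDl.
- rewrite eqxx notk// -ltr_pdivrMl// mulrC.
  by rewrite (le_lt_trans (leM j sj))// ltrDl.
- by rewrite eqxx notk// mulrDr; have := he i; rewrite si; lra.
- by rewrite !notk//; apply: le_lt_trans (hw i j si sj);
    rewrite ler_wpM2r ?(ltW (w0 _))// le_max lexx.
Qed.

(** Where [u i > 0], taking [z i] as the inverse of [u i] makes the cone condition automatic from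
    the definition of [h]; strict decay relative to [g] is needed only off the support. *)
Lemma maxtimes_unstable_cone (R : realFieldType) (I : finType) (g : R)
    (A : I -> I -> R) (v : I -> R) :
  0 < g -> (forall i j, 0 <= A i j) -> (exists i, 0 < v i) ->
  (forall i, exists j, g * v i <= A i j * v j) ->
  exists u z : I -> R, [/\ forall i, 0 <= u i, forall i, 0 < z i,
    exists i, 0 < u i, forall j, exists i, g * u j <= u i * A i j &
    forall i, u i * z i = 1 \/ u i = 0 /\ forall j, A i j * z j < g * z i].
Proof.
move=> g0 A0 [i0 vi0] hv.
pose P (S : {set I}) (u : I -> R) := [/\ forall i, 0 <= u i,
  forall i, (0 < u i) = (i \in S) & forall j, exists i, g * u j <= u i * A i j].
have P0 : `[< exists u, P finset.set0 u >].
  apply/asboolP; exists (fun=> 0); split=> // [i|j].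
    by rewrite ltxx finset.in_set0.
  by exists j; rewrite mulr0 mul0r.
case: (arg_maxnP (P := fun S => `[< exists u, P S u >])
  (fun S : {set I} => #|S|) P0) => S /asboolP[u [u0 uS hu]] maxS.
have uC i : i \notin S -> u i = 0.
  by rewrite -uS lt_neqAle u0 andbT negbK => /eqP.
have [|[w [w0 hw]]] :=
    maxtimes_alternative R I g (enum (finset.setC S)) A g0 (enum_uniq _) A0.
  (* The supports of [u] and [u'] are disjoint, so [u + u'] is again admissible and has larger
     support, against maximality. *)
  case=> u' [u'0 u'S [k u'k] hu'].
  have u'E i : i \in S -> u' i = 0.
    by move=> iS; apply: u'S; rewrite mem_enum finset.inE iS.
  have kS : k \notin S by apply/negP => /u'E u'k0; rewrite u'k0 ltxx in u'k.
  pose S' := (S :|: [set i | 0 < u' i])%SET.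
  suff /asboolP/maxS : exists y, P S' y.
    have : (#|S| < #|S'|)%N.
      apply: proper_card; apply/properP; split; first exact: finset.subsetUl.
      by exists k; rewrite // !finset.inE u'k orbT.
    by rewrite ltnNge => /negP.
  exists (fun i => u i + u' i); split=> [i|i|j].
  - by rewrite addr_ge0.
  - rewrite !finset.inE; have [iS|iS] /= := boolP (i \in S).
      by rewrite u'E// addr0 uS.
    by rewrite uC// add0r.
  - have [jS|jS] := boolP (j \in S).
      have [i hi] := hu j; exists i; rewrite u'E// addr0; apply: (le_trans hi).
      by rewrite ler_wpM2r// lerDl.
    have [i hi] := hu' j; exists i; rewrite uC// add0r; apply: (le_trans hi).
    by rewrite ler_wpM2r// lerDr.
have {}hw i j : i \notin S -> j \notin S -> A i j * w j < g * w i.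
  by move=> iS jS; apply: hw; rewrite mem_enum finset.inE.
(* Dividing [w] by a small [e] raises [z] off the support until the entries leading into the support
   are dominated too. Where [u p.2 = 0] the quotient is 0 and the constraint is vacuous. *)
have [|e e0 he] := @ex_small_scale R (I * I)%type (fun p => A p.1 p.2 / u p.2)
    (fun p => g * w p.1).
  by move=> p; rewrite mulr_gt0.
exists u, (fun i => if i \in S then (u i)^-1 else w i / e); split=> // [i||i].
- by case: ifP => iS; [rewrite invr_gt0 uS|rewrite divr_gt0].
(* If [u] vanished, [hw] would hold for all indices. At an [i] maximizing [v i / w i] this gives
   [A i j * v j < g * v i] for every [j], contradicting [hv]. *)
- apply: contrapT => nu.
  have nS i : i \notin S.
    by rewrite -uS; apply/negP => ui; apply: nu; exists i.
  have [i _ hi] := @arg_maxP _ R I i0 xpredT (fun i => v i / w i) isT.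
  have vwi : 0 < v i / w i.
    by apply: lt_le_trans (hi i0 isT); rewrite divr_gt0.
  have [j] := hv i; apply/negP; rewrite -ltNge.
  apply: (@le_lt_trans _ _ (A i j * w j * (v i / w i))).
    rewrite -mulrA ler_wpM2l// mulrC -ler_pdivrMr//; exact: hi.
  rewrite (_ : g * v i = g * w i * (v i / w i)); first by rewrite ltr_pM2r// hw.
  by field; rewrite gt_eqF.
- case: ifPn => iS; first by left; rewrite divff// gt_eqF// uS.
  right; split=> [|j]; first exact: uC.
  rewrite [ltRHS]mulrA ltr_pdivlMr// mulrC; case: ifPn => jS; first exact: (he (i, j)).
  by rewrite mulrCA [e * _]mulrC divfK ?gt_eqF// hw.
Qed.

(** * Exponential dictionary, and identification of the Jacobian *)

Section MaxTimesModel.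
Variable R : realType.
Implicit Types (a b : Rmax R).

Lemma texp_ge0 a : 0 <= texp a.
Proof. by case: a => [r|] //=; exact: expR_ge0. Qed.

Lemma texp_tadd a b : texp (tadd a b) = Num.max (texp a) (texp b).
Proof.
case: a b => [r|] [s|] /=; rewrite ?maxxx//.
- by case: (leP r s) => rs; [rewrite max_r|rewrite max_l]; rewrite // ler_expR// ltW.
- by rewrite max_l// expR_ge0.
- by rewrite max_r// expR_ge0.
Qed.

Lemma texp_tmul a b : texp (tmul a b) = texp a * texp b.
Proof.
by case: a b => [r|] [s|] /=; rewrite ?expRD ?mul0r ?mulr0.
Qed.

Lemma texp_tdiv a (r : R) : texp (tdiv a r) = texp a / expR r.
Proof. by case: a => [s|] /=; rewrite ?mul0r// expRD expRN. Qed.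

Lemma texp_inj : injective (@texp R).
Proof.
case=> [r|] [s|] //=; first by move=> /expR_inj ->.
- by move=> /eqP; rewrite gt_eqF// expR_gt0.
- by move=> /eqP; rewrite lt_eqF// expR_gt0.
Qed.

Lemma texp_tmulmx m n p (A : 'M[Rmax R]_(m, n)) (B : 'M[Rmax R]_(n, p)) i j :
  texp (tmulmx A B i j) = \big[Num.max/0]_k (texp (A i k) * texp (B k j)).
Proof.
rewrite mxE (big_morph (@texp R) texp_tadd (erefl _)).
by apply: eq_bigr => k _; rewrite texp_tmul.
Qed.

Section Vectors.
Context {n : nat}.
Implicit Types x : 'cV[Rmax R]_n.

Lemma tnormE x : tnorm x = \big[Num.max/0]_i texp (x i 0).
Proof.
by apply: eq_bigr => i _; rewrite /tdist mxE /= subr0 ger0_norm// texp_ge0.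
Qed.

Lemma texp_le_tnorm x i : texp (x i 0) <= tnorm x.
Proof. by rewrite tnormE; exact: le_bigmax. Qed.

Lemma tnorm_le x (c : R) :
  0 <= c -> (forall i, texp (x i 0) <= c) -> tnorm x <= c.
Proof. by move=> c0 xc; rewrite tnormE; apply: bigmax_le. Qed.

Lemma tneq0P x : x <> tzerov -> exists i, 0 < texp (x i 0).
Proof.
move=> x0; apply: contrapT => nx; apply: x0; apply/colP => i; rewrite mxE.
apply: texp_inj; apply/eqP; rewrite eq_le texp_ge0 andbT leNgt.
by apply/negP => xi; apply: nx; exists i.
Qed.

Lemma texp_tsingle (j : 'I_n) a i :
  texp (tsingle j a i 0) = if i == j then texp a else 0.
Proof. by rewrite mxE; case: ifP. Qed.

Lemma tnorm_tsingle (j : 'I_n) a : tnorm (tsingle j a) = texp a.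
Proof.
apply/eqP; rewrite eq_le; apply/andP; split.
  apply: tnorm_le => [|i]; first exact: texp_ge0.
  by rewrite texp_tsingle; case: ifP => // _; exact: texp_ge0.
by apply: le_trans (texp_le_tnorm _ j); rewrite texp_tsingle eqxx.
Qed.

Lemma tdist_approx (g : 'cV[Rmax R]_n -> Rmax R) (a : 'rV[Rmax R]_n) (e : R) :
  is_tlinear_approx g a -> 0 < e -> exists2 d : R, 0 < d &
    forall x, 0 < tnorm x -> tnorm x < d ->
      tdist (g x) (tmulmx a x 0 0) < e * tnorm x.
Proof.
move=> ga /ga[d [d0 hd]]; exists d => // x x0 xd.
rewrite -ltr_pdivrMr//; apply: hd => // xz; rewrite xz tnormE in x0.
suff : \big[Num.max/0]_(i < n) texp (tzerov i 0) <= 0 :> R by rewrite leNgt x0.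
by apply: bigmax_le => // i _; rewrite mxE.
Qed.

(** On [tsingle j (tfin r)] the form keeps only its [j]th term and the norm is [expR r], so the
    approximation quotient is exactly the distance that must tend to 0. *)
Lemma is_tderiv_approx (g : 'cV[Rmax R]_n -> Rmax R) (a : 'rV[Rmax R]_n) j :
  is_tlinear_approx g a -> is_tderiv g j (a 0 j).
Proof.
move=> ga e e0; have [d d0 hd] := tdist_approx g a e ga e0.
exists d; split=> // r; rewrite {1}/tdist /= subr0 ger0_norm ?expR_ge0// => rd.
have := hd (tsingle j (tfin r)); rewrite tnorm_tsingle /= => /(_ (expR_gt0 r) rd).
rewrite /tdist texp_tmulmx.
have -> : \big[Num.max/0]_k (texp (a 0 k) * texp (tsingle j (tfin r) k 0)) =
    texp (a 0 j) * expR r.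
  apply/eqP; rewrite eq_le; apply/andP; split.
    apply: bigmax_le => [|k _]; first by rewrite mulr_ge0 ?texp_ge0 ?expR_ge0.
    rewrite texp_tsingle; case: eqVneq => [->//|_].
    by rewrite mulr0 mulr_ge0 ?texp_ge0 ?expR_ge0.
  apply: le_trans (le_bigmax _ _ j).
  by rewrite texp_tsingle eqxx.
rewrite texp_tdiv -ltr_pdivrMr ?expR_gt0//.
rewrite -[X in _ / X](@ger0_norm _ (expR r)) ?expR_ge0// -normf_div mulrBl mulfK//.
by rewrite gt_eqF// expR_gt0.
Qed.

Lemma is_tderiv_unique (g : 'cV[Rmax R]_n -> Rmax R) j a b :
  is_tderiv g j a -> is_tderiv g j b -> a = b.
Proof.
move=> ga gb; apply: texp_inj; apply/eqP; rewrite -subr_eq0 -normr_le0.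
apply/ler_addgt0Pl => e e0; rewrite addr0.
have e20 : 0 < e / 2 by rewrite divr_gt0.
have [d1 [d10 h1]] := ga _ e20; have [d2 [d20 h2]] := gb _ e20.
(* [ln d] is a finite test point at distance [d] from -oo, strictly inside both radii. *)
pose d := Num.min d1 d2 / 2.
have d0 : 0 < d by rewrite divr_gt0// lt_min d10.
have dm : d < Num.min d1 d2.
  by rewrite /d ltr_pdivrMr// mulr_natr mulr2n ltrDl lt_min d10.
have : tdist (tfin (ln d)) tzero < Num.min d1 d2.
  by rewrite /tdist /= subr0 lnK ?posrE// ger0_norm// ltW.
rewrite lt_min => /andP[/h1 {}h1 /h2 {}h2].
move: h1 h2; rewrite /tdist; set c := texp (tdiv _ _) => h1 h2.
have := ler_normB (c - texp b) (c - texp a).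
have -> : c - texp b - (c - texp a) = texp a - texp b by ring.
lra.
Qed.

Lemma tderiv_approx (g : 'cV[Rmax R]_n -> Rmax R) (a : 'rV[Rmax R]_n) j :
  is_tlinear_approx g a -> tderiv g j = a 0 j.
Proof.
move=> /(@is_tderiv_approx _ _ j) ga.
(* [a 0 j] is a limit, so [xget] does not fall back on its default. *)
have gt : is_tderiv g j (tderiv g j).
  by rewrite /tderiv; case: xgetP => [l _ //|/(_ _ ga)].
exact: is_tderiv_unique gt ga.
Qed.

Lemma tjacobian_approx (f : 'cV[Rmax R]_n -> 'cV[Rmax R]_n) i :
  tlinearly_approximated f ->
  is_tlinear_approx (fun x => f x i 0) (row i (tjacobian f)).
Proof.
move=> /(_ i)[a fa]; suff -> : row i (tjacobian f) = a by [].
by apply/rowP => j; rewrite !mxE; exact: tderiv_approx.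
Qed.

End Vectors.
End MaxTimesModel.

(** * Perturbed dynamics on the cone and escape of orbits *)

Lemma maxtimes_cone_step (R : realFieldType) (I : finType) (g e Z U N : R)
    (A : I -> I -> R) (u z x y : I -> R) :
  let h (t : I -> R) := \big[Num.max/0]_i (u i * t i) in
  0 < g -> 0 < e -> 0 <= Z -> 0 <= U -> (forall i, 0 <= u i <= U) ->
  (forall i, 0 < z i) -> (forall i j, 0 <= A i j) -> (forall i, 0 <= x i) ->
  (forall j, exists i, g * u j <= u i * A i j) ->
  (forall i, u i * z i = 1 \/
     forall j, A i j * z j + e * Z <= (g - e * Z * U) * z i) ->
  (forall i, `|y i - \big[Num.max/0]_j (A i j * x j)| <= e * N) ->
  N <= Z * h x -> (forall i, x i <= h x * z i) ->
  (g - e * Z * U) * h x <= h y /\ forall i, y i <= h y * z i.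
Proof.
move=> h g0 e0 Z0 U0 uU z0 A0 x0 hu hz yA NZ xz.
have u0 i : 0 <= u i by have /andP[] := uU i.
have eN : e * N <= e * Z * h x by rewrite -mulrA ler_pM2l.
have h0 t : 0 <= h t by exact: bigmax_ge_id.
have hge t i : u i * t i <= h t by exact: (le_bigmax _ (fun i => u i * t i)).
have eZ0 : 0 <= e * Z by rewrite mulr_ge0// ltW.
(* The index from [hu] gives growth by [g] for [A] itself; the error, at most [e * Z * h x] per
   coordinate, is weighted by at most [U]. *)
have grow : (g - e * Z * U) * h x <= h y.
  rewrite mulrBl lerBlDr -ler_pdivlMl//; apply: bigmax_le => [|j _].
    by rewrite mulr_ge0 ?invr_ge0 ?(ltW g0)// addr_ge0// mulr_ge0// mulr_ge0.
  rewrite ler_pdivlMl// mulrA; have [i hi] := hu j.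
  apply: (le_trans (ler_wpM2r (x0 j) hi)).
  apply: (@le_trans _ _ (u i * (y i + e * Z * h x))).
    rewrite -[leLHS]mulrA ler_wpM2l//.
    apply: (le_trans (le_bigmax 0 (fun j => A i j * x j) j)).
    by have := yA i; rewrite ler_norml; lra.
  rewrite mulrDr lerD// mulrC -!mulrA !ler_wpM2l//; first exact: ltW.
  by rewrite mulrC ler_wpM2r//; have /andP[] := uU i.
(* On the support the cone bound is [u i * y i <= h y]. Elsewhere the slack [e * Z] in [Az] absorbs
   the error, and [grow] passes from [h x] to [h y]. *)
split=> // i; have [uz|Az] := hz i.
  rewrite -[leLHS]mulr1 -uz mulrA [y i * _]mulrC.
  by rewrite ler_wpM2r// ltW.
apply: (@le_trans _ _ ((g - e * Z * U) * h x * z i)); last first.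
  by rewrite ler_wpM2r// ltW.
have : \big[Num.max/0]_j (A i j * x j) <= ((g - e * Z * U) * z i - e * Z) * h x.
  have c0 j : A i j * z j <= (g - e * Z * U) * z i - e * Z by rewrite lerBrDr.
  apply: bigmax_le => [|j _].
    by rewrite mulr_ge0// (le_trans _ (c0 i))// mulr_ge0// ltW.
  apply: (@le_trans _ _ (A i j * (h x * z j))); first by rewrite ler_wpM2l.
  by rewrite mulrCA mulrC ler_wpM2r.
by have := yA i; rewrite ler_norml mulrBl mulrAC; lra.
Qed.

Theorem theorem4p3 (R : realType) (n : nat) (hn : (1 <= n)%N)
    (f : 'cV[Rmax R]_n -> 'cV[Rmax R]_n)
    (hfix : f tzerov = tzerov)
    (hf : tlinearly_approximated f)
    (lam : Rmax R)
    (hlam : is_max_teigenvalue (tjacobian f) lam)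
    (hpos : tlt (tfin 0%R) lam) :
  tunstable f.
Proof.
case: lam hlam hpos => [l|//] [[v [/tneq0P vpos eigv]] _] /= l0.
pose g := expR l; have g1 : 1 < g by rewrite -expR0 ltr_expR.
have g0 : 0 < g by exact: expR_gt0.
pose A i j := texp (tjacobian f i j).
have A0 i j : 0 <= A i j by exact: texp_ge0.
have hv i : exists j, g * texp (v i 0) <= A i j * texp (v j 0).
  have := congr1 (fun M : 'cV_n => texp (M i 0)) eigv.
  rewrite /tscale texp_tmulmx mxE texp_tmul /= -/g => <-.
  have [j _ hj] := @arg_maxP _ R 'I_n i xpredT
    (fun j => A i j * texp (v j 0)) isT.
  exists j; apply: bigmax_le => [|k _]; first by rewrite mulr_ge0// texp_ge0.
  exact: hj.
have [u [z [u0 z0 [j0 uj0] hu hz]]] := maxtimes_unstable_cone R _ g A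
  (fun i => texp (v i 0)) g0 A0 vpos hv.
pose Z := \sum_i z i; pose U := \sum_i u i.
have Z0 : 0 <= Z by apply: sumr_ge0 => i _; exact: ltW.
have U0 : 0 <= U by exact: sumr_ge0.
have zZ i : z i <= Z.
  by rewrite /Z (bigD1 i)//= lerDl sumr_ge0// => k _; exact: ltW.
have uU i : 0 <= u i <= U.
  by rewrite u0 /= /U (bigD1 i)//= lerDl sumr_ge0.
(* [None] keeps the perturbed rate [s] above 1; a pair [(i, j)] with [u i = 0] provides the slack
   for the cone step. The bound 1 for other pairs is a filler. *)
have [|e e0 he] := @ex_small_scale R (option ('I_n * 'I_n))
  (fun o => if o is Some p then Z + Z * U * z p.1 else Z * U)
  (fun o => if o is Some p then
     if u p.1 == 0 then g * z p.1 - A p.1 p.2 * z p.2 else 1 else g - 1).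
  case=> [[i j]|]; last by rewrite subr_gt0.
  have [ui0|//] /= := eqVneq (u i) 0; rewrite subr_gt0.
  case: (hz i) => [|[_ //]]; rewrite ui0 mul0r => /eqP.
  by rewrite eq_sym oner_eq0.
pose s := g - e * Z * U.
have s1 : 1 < s by have := he None; rewrite /s; lra.
have hz' i : u i * z i = 1 \/ forall j, A i j * z j + e * Z <= s * z i.
  case: (hz i) => [|[ui0 _]]; [by left|right=> j].
  by have := he (Some (i, j)); rewrite /= ui0 eqxx /s; lra.
have [d d0 hd] : exists2 d : R, 0 < d & forall x, 0 < tnorm x -> tnorm x < d ->
    forall i, `|texp (f x i 0) - \big[Num.max/0]_j (A i j * texp (x j 0))|
      <= e * tnorm x.
  have /choice[dd hdd] i : exists d : R, 0 < d /\
      forall x, 0 < tnorm x -> tnorm x < d ->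
        tdist (f x i 0) (tmulmx (row i (tjacobian f)) x 0 0) < e * tnorm x.
    by have [d] := tdist_approx _ _ _ _ (tjacobian_approx R f i hf) e0; exists d.
  exists (\big[Num.min/1]_i dd i) => [|x x0 xd i].
    by apply: lt_bigmin => // i _; have [] := hdd i.
  have [_ /(_ x x0 (lt_le_trans xd (bigmin_le _ i _)))] := hdd i.
  rewrite /tdist texp_tmulmx => /ltW; congr (`|_ - _| <= _).
  by apply: eq_bigr => j _; rewrite mxE.
(* Stability at radius [d] would keep the whole orbit where the linear approximation is valid. *)
move=> /(_ d d0)[r [r0 hr]].
(* Norm [r / 2], and [h x0 > 0] because [u j0 > 0]; [u j0 * z j0 = 1] puts [x0] in the cone. *)
pose x0 := tsingle j0 (tfin (ln (r / 2))).
have r20 : 0 < r / 2 by rewrite divr_gt0.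
have x0r : tnorm x0 < r.
  by rewrite tnorm_tsingle /= lnK ?posrE// ltr_pdivrMr// mulr_natr mulr2n ltrDl.
have {}hr t := hr x0 x0r t.
pose h (x : 'cV[Rmax R]_n) := \big[Num.max/0]_i (u i * texp (x i 0)).
have h0 x : 0 <= h x by exact: bigmax_ge_id.
have hge (x : 'cV[Rmax R]_n) i : u i * texp (x i 0) <= h x.
  exact: (le_bigmax _ (fun i => u i * texp (x i 0))).
have hx0 : 0 < h x0.
  apply: lt_le_trans (hge x0 j0).
  by rewrite mulr_gt0// texp_tsingle eqxx expR_gt0.
have hN x : h x <= U * tnorm x.
  apply: bigmax_le => [|i _].
    by rewrite mulr_ge0// (le_trans _ (texp_le_tnorm _ _ j0))// texp_ge0.
  have /andP[ui uiU] := uU i.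
  by rewrite ler_pM// ?texp_ge0// texp_le_tnorm.
have orbit t : s ^+ t * h x0 <= h (iter t f x0) /\
    forall i, texp (iter t f x0 i 0) <= h (iter t f x0) * z i.
  elim: t => [|t [IHh IHz]].
    rewrite expr0 mul1r; split=> // i; rewrite /= texp_tsingle.
    case: eqVneq => [->|_]; last by rewrite mulr_ge0// ltW.
    have [uz|[uj0' _]] := hz j0; last by rewrite uj0' ltxx in uj0.
    rewrite -[leLHS]mulr1 -[X in _ * X <= _]uz mulrA.
    rewrite ler_wpM2r ?(ltW (z0 _))// mulrC.
    by apply: le_trans (hge x0 j0); rewrite texp_tsingle eqxx.
  set x := iter t f x0 in IHh IHz *.
  have hx : 0 < h x by apply: lt_le_trans IHh; rewrite mulr_gt0// exprn_gt0//; lra.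
  have Nx : 0 < tnorm x.
    rewrite ltNge; apply/negP => Nx; have := hN x.
    by rewrite leNgt (le_lt_trans _ hx)// mulr_ge0_le0.
  have NZ : tnorm x <= Z * h x.
    apply: tnorm_le => [|i]; first by rewrite mulr_ge0.
    by apply: (le_trans (IHz i)); rewrite mulrC ler_wpM2r.
  have [|grow cone] := @maxtimes_cone_step R _ g e Z U (tnorm x) A u z
    (fun i => texp (x i 0)) (fun i => texp (f x i 0))
    g0 e0 Z0 U0 uU z0 A0 (fun i => texp_ge0 _ _) hu hz' (hd x Nx (hr t)) NZ.
    exact: IHz.
  split=> //; rewrite exprS -mulrA; apply: le_trans grow.
  by rewrite ler_pM2l//; lra.
(* This linear lower bound on [s ^+ t] suffices to exceed the bound [U * d] on [h] along the orbit,
   by the Archimedean property. *)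
have bernoulli t : 1 + t%:R * (s - 1) <= s ^+ t.
  elim: t => [|t IH]; first by rewrite mul0r addr0.
  have s0 : 0 <= s by lra.
  rewrite exprS -natr1; apply: le_trans (ler_wpM2l s0 IH).
  by have := mulr_ge0 (ler0n R t) (sqr_ge0 (s - 1)); lra.
have bounded t : (1 + t%:R * (s - 1)) * h x0 <= U * d.
  apply: le_trans (le_trans (hN (iter t f x0)) _); last first.
    by rewrite ler_wpM2l// ltW.
  by apply: le_trans (orbit t).1; rewrite ler_pM2r.
have sh0 : 0 < (s - 1) * h x0 by rewrite mulr_gt0// subr_gt0.
have := archi_boundP (divr_ge0 (mulr_ge0 U0 (ltW d0)) (ltW sh0)).
have := bounded (Num.bound (U * d / ((s - 1) * h x0))).
set N := (Num.bound _)%:R; rewrite ltr_pdivrMr//; lra.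
Qed.
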